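(* Let $h>0$, $a\in\mathbb{R}$, $\nu\in(0,1]$, let $y:(h\mathbb{N})_a\to\mathbb{R}$ satisfy $y(t)\ge0$ for all $t\in(h\mathbb{N})_a$, and let $l\in\{2k+1:k\in\mathbb{N},\,k\ge1\}$. Then $$({}_a\Delta_{h,\ast}^{\nu}y^{l})(t)\le l\,y^{l-1}(t+\nu h)\,({}_a\Delta_{h,\ast}^{\nu}y)(t),\qquad t\in(h\mathbb{N})_{a+(1-\nu)h}.$$
   Context: For $h>0$ and $a\in\mathbb{R}$, $(h\mathbb{N})_a=\{a,a+h,a+2h,\dots\}$, $\sigma(t)=t+h$, and $(\Delta_h y)(t)=\frac{y(t+h)-y(t)}{h}$. The $h$-factorial function is $t_h^{(\alpha)}=h^{\alpha}\frac{\Gamma(t/h+1)}{\Gamma(t/h+1-\alpha)}$, taken to be $0$ when $t/h+1-\alpha$ is a nonpositive integer and $t/h+1$ is not. For $\mu>0$ the fractional $h$-sum is $({}_a\Delta_h^{-\mu}y)(t)=\frac{h}{\Gamma(\mu)}\sum_{s=a/h}^{t/h-\mu}(t-\sigma(sh))_h^{(\mu-1)}y(sh)$ for $t\in(h\mathbb{N})_{a+\mu h}$, where $s$ runs over $a/h,a/h+1,\dots,t/h-\mu$ and $\sigma(sh)=(s+1)h$; and ${}_a\Delta_h^{0}y=y$. For $\nu\in(0,1]$ the Caputo-like fractional $h$-difference is $({}_a\Delta_{h,\ast}^{\nu}y)(t)=({}_a\Delta_h^{-(1-\nu)}(\Delta_h y))(t)$, $t\in(h\mathbb{N})_{a+(1-\nu)h}$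 (so it equals $\Delta_h y$ if $\nu=1$). Here $y^{l}$ is the pointwise power and $y^{l-1}(t+\nu h)=(y(t+\nu h))^{l-1}$. *)

(* Defs.v *)
From HB Require Import structures.
From mathcomp Require Import all_boot all_order all_algebra.
From mathcomp Require Import all_classical all_reals all_analysis.

Set Implicit Arguments.
Unset Strict Implicit.
Unset Printing Implicit Defensive.

Import Order.TTheory GRing.Theory Num.Theory.
Import numFieldNormedType.Exports.

Local Open Scope classical_set_scope.
Local Open Scope ring_scope.

Definition EulerGamma (R : realType) (x : R) : R :=
  \int[lebesgue_measure]_(u in `]0, +oo[) (u `^ (x - 1) * expR (- u)).

(* For x <= 0, [n] is the least natural number with 0 < x + n, and the value is
   the extension of the integral through Gamma (x + 1) = x * Gamma x.  At the
   poles the product vanishes and, since 0^-1 = 0, the junk value is 0. *)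
Definition Gamma (R : realType) (x : R) : R :=
  if 0 < x then EulerGamma x else
  let n := (Num.truncn (- x)).+1 in
  EulerGamma (x + n%:R) / \prod_(i < n) (x + i%:R).

Definition hgrid (R : realType) (h a : R) : set R :=
  [set t | exists n : nat, t = a + n%:R * h].

(* Functions on a grid are represented by functions on R; the operators below,
   applied at points of their domain, only read values at grid points. *)

Definition hsigma (R : realType) (h t : R) : R := t + h.

Definition hdiff (R : realType) (h : R) (y : R -> R) (t : R) : R :=
  (y (t + h) - y t) / h.

Definition nonpos_int (R : realType) (x : R) : bool := - x \is a Num.nat.

Definition hfactorial (R : realType) (h t alpha : R) : R :=
  if nonpos_int (t / h + 1 - alpha) && ~~ nonpos_int (t / h + 1) then 0
  else h `^ alpha * (Gamma (t / h + 1) / Gamma (t / h + 1 - alpha)).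

(* f b + f (b + 1) + ... + f c, for real b and c with c - b an integer;
   the sum is empty when c < b. *)
Definition unit_step_sum (R : realType) (b c : R) (f : R -> R) : R :=
  \sum_(0 <= k < Num.truncn (c - b + 1)) f (b + k%:R).

(* The fractional sum of order mu >= 0, i.e. the operator with exponent -mu. *)
Definition hsum (R : realType) (h a mu : R) (y : R -> R) (t : R) : R :=
  if mu == 0 then y t else
  h / Gamma mu * unit_step_sum (a / h) (t / h - mu)
    (fun s => hfactorial h (t - hsigma h (s * h)) (mu - 1) * y (s * h)).

Definition caputo_hdiff (R : realType) (h a nu : R) (y : R -> R) : R -> R :=
  hsum h a (1 - nu) (hdiff h y).

(* Main.v *)
Require Import Defs.
From HB Require Import structures.
From mathcomp Require Import all_boot all_order all_algebra.
From mathcomp Require Import all_classical all_reals all_analysis.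
From mathcomp Require Import measurable_realfun ring.

Import Order.TTheory GRing.Theory Num.Theory.
Import numFieldNormedType.Exports.
Local Open Scope classical_set_scope.
Local Open Scope ring_scope.

(** Write mu = 1 - nu, t = a + mu h + n h, Y_k = y (a + k h), so that
y (t + nu h) = Y_(n+1). For nu < 1 the Caputo difference is, up to a nonnegative
constant factor, a weighted sum of the increments Y_(k+1) - Y_k for k <= n, the
weight of index k being w_(n-k) with w_j = Gamma (mu + j) / Gamma (j + 1)
([caputo_hdiff_sum]). Subtracting the two sides of the inequality therefore
gives the weighted sum of the increments of
   z_k = Y_k^l + (l - 1) Y_(n+1)^l - l Y_(n+1)^(l-1) Y_k,
the gap between u^l at u = Y_k and its tangent line at Y_(n+1); the added
constant does not affect the increments. By convexity of u^l on [0, +oo[ every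
z_k is nonnegative ([tangent_line_exprS]), and z_(n+1) = 0.

The weights are nonnegative, and w_(j+1) = (mu + j) / (j + 1) w_j <= w_j because
mu <= 1; hence w_(n-k) is nondecreasing in k, and summation by parts leaves only
nonpositive terms besides w_0 z_(n+1) = 0 ([abel_sum_le]). For nu = 1 the
operator is the plain difference quotient and the inequality reduces to
z_n >= 0.

The recursion for w_j rests on Gamma (x + 1) = x Gamma x, which is obtained by
integrating by parts on the segments [exp (- N), N] and letting N go to
infinity. The limit is taken in the extended reals, so that the convergence of
the integral need not be discussed: in that form the identity is
meaningful, and is preserved by [fine], whether or not the integrals
are finite. *)

(** * Convexity and summation by parts *)

(** The tangent inequality for u^(m+1) at v, by induction on m: multiplying the
case m by u and subtracting from the case m + 1 leaves
(m + 1) v^m (u - v)^2. *)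
Lemma tangent_line_exprS {R : realDomainType} (u v : R) (m : nat) :
  0 <= u -> 0 <= v -> m.+1%:R * v ^+ m * u <= u ^+ m.+1 + m%:R * v ^+ m.+1.
Proof.
move=> u0 v0; elim: m => [|m IH].
  by rewrite expr0 !mulr1 expr1 mul0r addr0 mul1r.
have H1 := ler_wpM2r u0 IH.
have H2 : 0 <= m.+1%:R * (v ^+ m * (u - v) ^+ 2).
  by rewrite mulr_ge0 ?ler0n// mulr_ge0 ?sqr_ge0// exprn_ge0.
have -> : u ^+ m.+2 = u ^+ m.+1 * u by rewrite exprSr.
have e1 : v ^+ m.+1 = v ^+ m * v by rewrite exprSr.
have e2 : v ^+ m.+2 = v ^+ m * v * v by rewrite !exprSr.
move: H1 H2; rewrite e2 e1.
rewrite -(natr1 m.+1) -(natr1 m).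
set M := m%:R; set V := v ^+ m; set U := u ^+ m.+1.
move=> H1 H2; rewrite -subr_ge0.
have H3 : 0 <= (U + M * (V * v)) * u - (M + 1) * V * u * u + (M + 1) * (V * (u - v) ^+ 2).
  by rewrite addr_ge0// subr_ge0.
by apply: le_trans H3 _; rewrite le_eqVlt; apply/orP; left; apply/eqP; ring.
Qed.

(** Summation by parts: the sum equals v_n z_(n+1) minus v_0 z_0 and minus the
nonnegative terms (v_k - v_(k-1)) z_k. *)
Lemma abel_sum_le {R : realDomainType} (v z : nat -> R) (n : nat) :
  (forall k, (k < n)%N -> v k <= v k.+1) -> 0 <= v 0%N ->
  (forall k, (k <= n)%N -> 0 <= z k) ->
  \sum_(0 <= k < n.+1) v k * (z k.+1 - z k) <= v n * z n.+1.
Proof.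
move=> + v0; elim: n => [|n IH] vS z0.
  by rewrite big_nat1 mulrBr gerBl mulr_ge0// z0.
rewrite big_nat_recr//=.
have {}IH : \sum_(0 <= k < n.+1) v k * (z k.+1 - z k) <= v n * z n.+1.
  by apply: IH => k kn; [apply: vS | apply: z0]; rewrite (leq_trans kn).
have h : v n * z n.+1 <= v n.+1 * z n.+1 by rewrite ler_wpM2r ?vS ?z0.
apply: (le_trans (lerD (le_trans IH h) (lexx _))).
by rewrite mulrBr addrC subrK.
Qed.

(** * The functional equation of the Gamma function *)

(** With m a natural number above x, the Taylor bound
exp u >= u^(m+1) / (m+1)! gives this with C = (m+1)!. The rate 1 / u makes the
boundary terms of the integration by parts comparable to the harmonic
sequence. *)
Lemma powR_expRN_le {R : realType} (x : R) : exists2 C : R, 0 <= C &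
  forall u, 1 <= u -> u `^ x * expR (- u) <= C * u^-1.
Proof.
pose m := Num.bound `|x|; exists (m.+1`!)%:R; first exact: ler0n.
move=> u u1; have u0 : 0 < u by exact: lt_le_trans u1.
have xm : u `^ x <= u ^+ m.
  rewrite -powR_mulrn; last exact: ltW.
  apply: ler_powR => //; apply: le_trans (ler_norm _) _.
  exact/ltW/archi_boundP.
apply: (le_trans (ler_wpM2r (expR_ge0 _) xm)).
rewrite expRN ler_pdivlMr// mulrAC -exprSr ler_pdivrMr ?expR_gt0//.
rewrite mulrC -ler_pdivrMr ?ltr0n ?fact_gt0//.
apply: le_trans (expR_ge1Dxn m (ltW u0)); by rewrite lerDr.
Qed.

Lemma expRN_le {R : realType} {u : R} : 0 < u -> expR (- u) <= u^-1.
Proof.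
move=> u0; rewrite expRN lef_pV2 ?posrE ?expR_gt0//.
by apply: le_trans (expR_ge1Dx u); rewrite lerDr.
Qed.

Lemma EulerGamma_parts {R : realType} (x a b : R) : 0 < a -> a < b ->
  (\int[lebesgue_measure]_(u in `[a, b]) (u `^ x * expR (- u))%:E =
   (a `^ x * expR (- a) - b `^ x * expR (- b))%:E +
   x%:E * \int[lebesgue_measure]_(u in `[a, b]) (u `^ (x - 1) * expR (- u))%:E)%E.
Proof.
move=> a0 ab.
have cpow (p v : R) : 0 < v -> {for v, continuous (fun u => u `^ p)}.
  move=> v0; apply/differentiable_continuous/derivable1_diffP.
  exact: (@ex_derive _ _ _ _ _ _ _ (is_derive1_powR p v0)).
have dG (v : R) : is_derive v 1 (fun u : R => - expR (- u)) (expR (- v)).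
  have dN : is_derive v 1 (-%R : R -> R) (- 1) := is_deriveNid v 1.
  have dE := @is_derive1_comp R expR -%R v _ _ (is_derive_expR (- v)) dN.
  by apply: is_derive_eq (is_deriveN dE) _; rewrite mulrN1 opprK.
have cexpN (v : R) : {for v, continuous (fun u => expR (- u))}.
  by apply: continuous_comp; [exact: continuousN | exact: continuous_expR].
have cG (v : R) : {for v, continuous (fun u => - expR (- u))}.
  by apply: continuousN; exact: cexpN.
have ab0 v : v \in `[a, b] -> 0 < v.
  by rewrite in_itv/= => /andP[av _]; exact: lt_le_trans av.
have cf : {within `[a, b], continuous (fun u => x * u `^ (x - 1))}.
  apply: continuous_in_subspaceT => v; rewrite inE/= => /ab0 v0.
  by apply: cvgM; [exact: cvg_cst | exact: cpow].
rewrite (@integration_by_parts R (fun u => u `^ x) (fun u => - expR (- u))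
   (fun u => x * u `^ (x - 1)) (fun u => expR (- u)))//.
- rewrite !mulrN opprK [X in X%:E]addrC.
  have -> : (fun u => (x * u `^ (x - 1) * - expR (- u))%:E) =
     (fun u => ((- x)%:E * (u `^ (x - 1) * expR (- u))%:E)%E).
    by apply/funext => u; rewrite -EFinM; congr (_%:E); ring.
  rewrite integralZl//; last first.
    apply: (@continuous_compact_integrable _ (fun u => u `^ (x - 1) * expR (- u))).
      exact: segment_compact.
    apply: continuous_in_subspaceT => v; rewrite inE/= => /ab0 v0.
    by apply: cvgM; [exact: cpow | exact: cexpN].
  by rewrite EFinN mulNe oppeK.
- have b0 := lt_trans a0 ab; split.
  + move=> v; rewrite in_itv/= => /andP[av _].
    exact: (@ex_derive _ _ _ _ _ _ _ (is_derive1_powR x (lt_trans a0 av))).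
  + exact/cvg_at_right_filter/cpow.
  + exact/cvg_at_left_filter/cpow.
- move=> v; rewrite in_itv/= => /andP[av _].
  by rewrite powR_derive1// in_itv/= andbT (lt_trans a0 av).
- by apply: continuous_subspaceT => v; exact: cexpN.
- split.
  + by move=> v _; exact: ex_derive.
  + exact/cvg_at_right_filter/cG.
  + exact/cvg_at_left_filter/cG.
- by move=> v _; rewrite derive1E derive_val.
Qed.

(** Monotone convergence along segments exhausting ]0, +oo[. The lower endpoint
exp (- N), rather than 1 / N, makes its x-th power the exponential exp (- N x),
so that [expRN_le] bounds the boundary term there. *)
Lemma EulerGamma_exhaustion {R : realType} (p : R) :
  (\int[lebesgue_measure]_(u in `[expR (- n.+1%:R), n.+1%:R]%classic)
      (u `^ p * expR (- u))%:E @[n --> \oo] -->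
   \int[lebesgue_measure]_(u in `]0%R, +oo[%classic) (u `^ p * expR (- u))%:E)%E.
Proof.
pose I n : set R := `[expR (- n.+1%:R), n.+1%:R]%classic.
have -> : `]0, +oo[%classic = \bigcup_n I n :> set R.
  apply/seteqP; split => u /=.
    rewrite in_itv/= andbT => u0.
    pose m := maxn (Num.bound u) (Num.bound u^-1).
    exists m => //; rewrite /I/= in_itv/=; apply/andP; split.
      apply: le_trans (expRN_le _) _; first exact: ltr0Sn.
      rewrite -[leRHS]invrK lef_pV2 ?posrE ?invr_gt0 ?ltr0Sn//.
      have /ltW/le_trans := @archi_boundP _ u^-1 (ltW (etrans (invr_gt0 _) u0)).
      by apply; rewrite ler_nat (leq_trans (leq_maxr _ _) (leqnSn _)).
    have /ltW/le_trans := @archi_boundP _ u (ltW u0).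
    by apply; rewrite ler_nat (leq_trans (leq_maxl _ _) (leqnSn _)).
  move=> [n _]; rewrite /I/= !in_itv/= andbT => /andP[+ _].
  exact/lt_le_trans/expR_gt0.
apply: (@ge0_nondecreasing_set_cvg_integral _ (measurableTypeR R) R I
  (fun u => (u `^ p * expR (- u))%:E) lebesgue_measure).
- apply/nondecreasing_seqP => n; rewrite subsetEset => u.
  rewrite /I/= !in_itv/= => /andP[nu un]; apply/andP; split.
    by apply: le_trans nu; rewrite ler_expR lerN2 ler_nat.
  by apply: le_trans un _; rewrite ler_nat.
- by move=> n; exact: measurable_itv.
- move=> n; apply/measurable_EFinP; apply: measurable_funTS.
  apply: measurable_funM; first exact: measurable_powR.
  by apply: measurableT_comp => //; exact: measurable_expR.
- by move=> n u _; rewrite lee_fin mulr_ge0 ?powR_ge0 ?expR_ge0.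
Qed.

Lemma EulerGamma_ge0 {R : realType} (x : R) : 0 <= EulerGamma x.
Proof.
by apply: Rintegral_ge0 => u _; rewrite mulr_ge0 ?powR_ge0 ?expR_ge0.
Qed.

(** The functional equation of Gamma as an identity between extended reals. *)
Lemma integral_powR_expRN {R : realType} (x : R) : 0 < x ->
  (\int[lebesgue_measure]_(u in `]0%R, +oo[%classic) (u `^ x * expR (- u))%:E =
   x%:E * \int[lebesgue_measure]_(u in `]0%R, +oo[%classic)
     (u `^ (x - 1) * expR (- u))%:E)%E.
Proof.
move=> x0.
(* c n is the boundary term of the integration by parts; both of its parts are
   O(1 / n). *)
pose c (n : nat) : R := expR (- n.+1%:R) `^ x * expR (- expR (- n.+1%:R))
  - n.+1%:R `^ x * expR (- n.+1%:R).
have c0 : c n @[n --> \oo] --> (0 : R).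
  have [C C0 HC] := powR_expRN_le x.
  have hN : - C * harmonic n @[n --> \oo] --> (0 : R).
    by rewrite -(mulr0 (- C)); apply: cvgMr; exact: cvg_harmonic.
  have hP : x^-1 * harmonic n @[n --> \oo] --> (0 : R).
    by rewrite -(mulr0 x^-1); apply: cvgMr; exact: cvg_harmonic.
  apply: squeeze_cvgr hN hP; apply: nearW => n; rewrite /harmonic/=; apply/andP; split.
    have P0 : 0 <= expR (- n.+1%:R) `^ x * expR (- expR (- n.+1%:R)).
      by rewrite mulr_ge0 ?powR_ge0 ?expR_ge0.
    have QC := HC n.+1%:R; rewrite ler1n in QC; have {}QC := QC isT.
    rewrite /c mulNr lerBrDr addrC; apply: le_trans (_ : 0 <= _) => //.
    by rewrite subr_le0.
  have Q0 : 0 <= n.+1%:R `^ x * expR (- n.+1%:R).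
    by rewrite mulr_ge0 ?powR_ge0 ?expR_ge0.
  rewrite /c lerBlDr; apply: le_trans (_ : x^-1 * n.+1%:R^-1 <= _); last by rewrite lerDl.
  rewrite -expRM -[leRHS]mulr1; apply: ler_pM; rewrite ?expR_ge0//.
  by rewrite mulNr -invfM mulrC expRN_le// mulr_gt0.
have L1 := EulerGamma_exhaustion x.
have L2 := EulerGamma_exhaustion (x - 1).
have L3 : ((c n)%:E + x%:E *
    \int[lebesgue_measure]_(u in `[expR (- n.+1%:R), n.+1%:R]%classic)
      (u `^ (x - 1) * expR (- u))%:E @[n --> \oo] -->
    0%:E + x%:E * \int[lebesgue_measure]_(u in `]0%R, +oo[%classic)
      (u `^ (x - 1) * expR (- u))%:E)%E.
  apply: cvgeD; first exact: fin_num_adde_defr.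
  - by apply: cvg_EFin => //; apply: nearW.
  - exact: cvgeZl.
rewrite -[RHS]add0e; apply: (cvg_unique _ L1) => //.
apply: cvg_trans L3; apply: near_eq_cvg; apply: nearW => n /=.
rewrite -(EulerGamma_parts x) ?expR_gt0//.
by rewrite (@lt_le_trans _ _ 1)// ?expR_lt1 ?oppr_lt0// ler1n.
Qed.

Lemma EulerGammaD1 {R : realType} (x : R) : 0 < x ->
  EulerGamma (x + 1) = x * EulerGamma x.
Proof.
move=> x0; rewrite /EulerGamma /Rintegral addrK integral_powR_expRN//.
(* The infinite values have real part 0, so they obey the identity too. *)
case: (integral _ _ _) => [r||] //=.
  by rewrite gt0_muley ?lte_fin//= mulr0.
by rewrite gt0_muleNy ?lte_fin//= mulr0.
Qed.

Lemma Gamma_pos_ge0 {R : realType} (x : R) : 0 < x -> 0 <= Gamma x.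
Proof. by move=> x0; rewrite /Gamma x0; exact: EulerGamma_ge0. Qed.

Lemma GammaD1 {R : realType} {x : R} : 0 < x -> Gamma (x + 1) = x * Gamma x.
Proof.
by move=> x0; rewrite /Gamma x0 addr_gt0// EulerGammaD1.
Qed.

(** * The weights of the fractional sum *)

(** By the functional equation the ratio of consecutive weights is
(mu + j) / (j + 1), which is at most 1 when mu <= 1. *)
Lemma Gamma_ratio_nonincreasing {R : realType} (mu : R) (j : nat) :
  0 < mu -> mu <= 1 ->
  Gamma (mu + j.+1%:R) / Gamma (j.+1%:R + 1) <= Gamma (mu + j%:R) / Gamma (j%:R + 1).
Proof.
move=> mu0 mu1.
have mj0 : 0 < mu + j%:R by rewrite ltr_pwDl ?ler0n.
have j0 : 0 < j%:R + 1 :> R by rewrite natr1 ltr0Sn.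
have -> : j.+1%:R = j%:R + 1 :> R by rewrite natr1.
rewrite addrA (GammaD1 mj0) (GammaD1 j0) invfM mulrACA.
rewrite ler_piMl//; first by rewrite divr_ge0 ?Gamma_pos_ge0.
by rewrite ler_pdivrMr// mul1r addrC lerD2l.
Qed.

(** On the grid the arguments of both Gamma factors are positive, so the
convention at the poles never applies. *)
Lemma hfactorial_kernel {R : realType} (h a mu : R) (n k : nat) :
  0 < h -> 0 < mu -> (k <= n)%N ->
  hfactorial h (a + mu * h + n%:R * h - hsigma h ((a / h + k%:R) * h)) (mu - 1) =
  h `^ (mu - 1) * (Gamma (mu + (n - k)%:R) / Gamma ((n - k)%:R + 1)).
Proof.
move=> h0 mu0 kn; rewrite /hfactorial /hsigma.
have hn0 : h != 0 by rewrite gt_eqF.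
have -> : (a + mu * h + n%:R * h - ((a / h + k%:R) * h + h)) / h + 1 =
    mu + (n - k)%:R by rewrite natrB//; field.
have -> : mu + (n - k)%:R - (mu - 1) = (n - k)%:R + 1 by ring.
rewrite ifF//; apply/negbTE; rewrite negb_and; apply/orP; left.
by apply/negP => /natr_ge0; rewrite oppr_ge0 natr1 lern0.
Qed.

(** The factor h of the fractional sum cancels the 1 / h of the difference
quotient. *)
Lemma caputo_hdiff_sum {R : realType} (h a nu : R) (y : R -> R) (n : nat) :
  0 < h -> nu < 1 ->
  caputo_hdiff h a nu y (a + (1 - nu) * h + n%:R * h) =
  h `^ (- nu) / Gamma (1 - nu) *
  \sum_(0 <= k < n.+1) Gamma (1 - nu + (n - k)%:R) / Gamma ((n - k)%:R + 1) *
     (y (a + k.+1%:R * h) - y (a + k%:R * h)).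
Proof.
move=> h0 nu1; have hn0 : h != 0 by rewrite gt_eqF.
have mu0 : 0 < 1 - nu by rewrite subr_gt0.
rewrite /caputo_hdiff /hsum (gt_eqF mu0) /unit_step_sum.
have -> : (a + (1 - nu) * h + n%:R * h) / h - (1 - nu) - a / h + 1 = n.+1%:R.
  by rewrite -natr1; field.
rewrite natrK !mulr_sumr; apply: eq_big_nat => k /andP[_ kn].
rewrite hfactorial_kernel// /hdiff.
have -> : (a / h + k%:R) * h = a + k%:R * h by field.
have -> : a + k%:R * h + h = a + k.+1%:R * h by rewrite -natr1; ring.
have -> : 1 - nu - 1 = - nu by ring.
by set G := (Gamma (1 - nu))^-1; set P := Gamma (_ + _) / _; field.
Qed.

(** * The power rule inequality *)

Theorem proposition4p1 (R : realType) (h a nu : R) (y : R -> R) (l : nat)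
  (h_gt0 : 0 < h) (nu_gt0 : 0 < nu) (nu_le1 : nu <= 1)
  (y_ge0 : forall t : R, hgrid h a t -> 0 <= y t)
  (l_odd : exists k : nat, (1 <= k)%N /\ l = (2 * k + 1)%N) :
  forall t : R, hgrid h (a + (1 - nu) * h) t ->
    caputo_hdiff h a nu (fun s => y s ^+ l) t
      <= l%:R * y (t + nu * h) ^+ (l - 1) * caputo_hdiff h a nu y t.
Proof.
move=> t [n ->]; case: l_odd => j [_ ->]; rewrite addn1 subn1 /=.
set m := (2 * j)%N.
have -> : a + (1 - nu) * h + n%:R * h + nu * h = a + n.+1%:R * h.
  by rewrite -natr1; ring.
pose Y k := y (a + k%:R * h).
have Y0 k : 0 <= Y k by apply: y_ge0; exists k.
rewrite -/(Y n.+1).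
(* The gap at Y k between u^l and its tangent line at Y n.+1, for l = m.+1. *)
pose z k := Y k ^+ m.+1 + m%:R * Y n.+1 ^+ m.+1 - m.+1%:R * Y n.+1 ^+ m * Y k.
have z0 k : 0 <= z k by rewrite subr_ge0; exact: tangent_line_exprS.
have zn : z n.+1 = 0.
  by rewrite /z -mulrA -exprSr -(natr1 m); ring.
have zB k : z k.+1 - z k = (Y k.+1 ^+ m.+1 - Y k ^+ m.+1)
    - m.+1%:R * Y n.+1 ^+ m * (Y k.+1 - Y k) by rewrite /z; ring.
(* For nu = 1 the order of the sum is 0: no Gamma weights are involved. *)
have [nu1|] := ltP nu 1; last first.
  move=> nu_ge1; have -> : nu = 1 by apply/eqP; rewrite eq_le nu_le1.
  rewrite /caputo_hdiff /hsum subrr eqxx mul0r addr0 /hdiff.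
  have -> : a + n%:R * h + h = a + n.+1%:R * h by rewrite -natr1; ring.
  rewrite mulrA ler_pM2r ?invr_gt0// -/(Y n) -/(Y n.+1) -subr_le0 -zB zn.
  by rewrite sub0r oppr_le0.
rewrite !caputo_hdiff_sum// mulrCA; apply: ler_wpM2l.
  by rewrite divr_ge0 ?powR_ge0// Gamma_pos_ge0// subr_gt0.
rewrite mulr_sumr -subr_le0 -sumrB.
pose v k := Gamma (1 - nu + (n - k)%:R) / Gamma ((n - k)%:R + 1).
rewrite (eq_bigr (fun k => v k * (z k.+1 - z k))); last first.
  by move=> k _; rewrite zB -/(v k) /Y; ring.
have mu0 : 0 < 1 - nu by rewrite subr_gt0.
suff : \sum_(0 <= k < n.+1) v k * (z k.+1 - z k) <= v n * z n.+1.
  by rewrite zn mulr0.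
apply: abel_sum_le => //.
- move=> k kn; rewrite /v -(subnSK kn); apply: Gamma_ratio_nonincreasing => //.
  by rewrite gerBl ltW.
- rewrite divr_ge0 ?Gamma_pos_ge0//; first by rewrite ltr_pwDl ?ler0n.
Qed.
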